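(* Let $u=(u(t,x))$ and $v=(v(t,x))$, $(t,x)\in[0,\infty)\times\mathbb{R}$, be arbitrary continuous real-valued random fields (on a common probability space). Let $U=(U_1,\dots,U_d)=(U(t,x),\,(t,x)\in[0,\infty)\times\mathbb{R})$ be a random field with values in $\mathbb{R}^d$ and with i.i.d. components, each with the law of $u$. Let $T>0$ and let $I\subset(0,T]$ and $J\subset\mathbb{R}$ be two compact intervals with positive length. Fix $0\le C<\infty$, and for each $(t_0,x_0)\in I\times J$ let $X_{t_0,x_0}$ be a random variable such that $|X_{t_0,x_0}|\le C$ a.s. Suppose that: (1) There are $H_1,H_2>0$ and $\alpha>1$ such that for all large $p\in\mathbb{N}$ there is $C_{T,p}<\infty$ such that for all large $n\in\mathbb{N}$ and all $(t_0,x_0)\in I\times J$, setting $R^{(n)}_{t_0,x_0}=[t_0,t_0+2^{-nH_1^{-1}}]\times[x_0,x_0+2^{-nH_2^{-1}}]$, $$L_{t_0,x_0}(t,x)=u(t,x)-u(t_0,x_0)-X_{t_0,x_0}\,(v(t,x)-v(t_0,x_0)),\qquad \mathcal{X}_n=\sup_{(t,x)\in R^{(n)}_{t_0,x_0}}|L_{t_0,x_0}(t,x)|,$$ we have $\mathrm{E}[(\mathcal{X}_n)^p]\le C_{T,p}\,2^{-\alpha pn}$. (2) For all $(t,x)\in I\times J$, $u(t,x)$ has an absolutely continuous probability law, and for all $M\in\mathbb{R}_+$, the probability density function $p_{t,x}(z)$ of $u(t,x)$ is bounded uniformly over $(t,x)\in I\times J$ and $z\in[-M,M]$. (3) There exists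 a constant $c=c(I,J)$ such that for all $(t_0,x_0)\in I\times J$ and all $\eta>0$ sufficiently small, writing $S_\eta=[t_0,t_0+\eta^{H_1^{-1}}]\times[x_0,x_0+\eta^{H_2^{-1}}]$, the $\mathbb{R}^2$-valued random vectors $$\Big(u(t_0,x_0),\ \sup_{(t,x)\in S_\eta}(v(t,x)-v(t_0,x_0))\Big)\quad\text{and}\quad\Big(-u(t_0,x_0),\ \sup_{(t,x)\in S_\eta}(-v(t,x)+v(t_0,x_0))\Big)$$ have joint probability density functions, denoted $p_+(\cdot,\cdot)$ and $p_-(\cdot,\cdot)$ respectively, that satisfy, for all $z_1\in\mathbb{R}$ and $z_2\ge\eta$, $$p_\pm(z_1,z_2)\le\frac{c}{\eta}\exp\left(-\frac{z_2^2}{c\,\eta^2}\right).$$ Then, for every $M>0$, there exists a constant $\tilde C=\tilde C(I,J,M)$ such that for all compact sets $A\subset[-M,M]^d$, $$\mathrm{P}\{U(I\times J)\cap A\neq\emptyset\}\le \tilde C\,\mathscr{H}_{d-H_1^{-1}-H_2^{-1}}(A).$$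
   Context: $U(I\times J)=\{U(t,x):(t,x)\in I\times J\}$. $\mathscr{H}_\beta(A)$ is the $\beta$-dimensional Hausdorff measure of $A\subset\mathbb{R}^d$ for $\beta\ge0$ ($\mathscr{H}_0$ is counting measure), with the convention $\mathscr{H}_\beta(A)=\infty$ if $\beta<0$. ''Sufficiently small'' and ''sufficiently large'' thresholds are uniform over $(t_0,x_0)\in I\times J$. *)

(* Defs.v *)
From HB Require Import structures.
From mathcomp Require Import all_boot all_order all_algebra.
From mathcomp Require Import all_classical all_reals all_analysis.
Set Implicit Arguments.
Unset Strict Implicit.
Unset Printing Implicit Defensive.
Import Order.TTheory GRing.Theory Num.Theory.
Import numFieldNormedType.Exports.
Local Open Scope classical_set_scope.
Local Open Scope ring_scope.

Section HausdorffMeasure.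
Context {R : realType} {d : nat}.
Implicit Types (A S : set 'rV[R]_d) (beta delta : R).

(* The norm carried by ['rV[R]_d] in the library is the sup norm. *)
Definition euclidean_dist (x y : 'rV[R]_d) : R :=
  Num.sqrt (\sum_(i < d) (x ord0 i - y ord0 i) ^+ 2).

(* Equals [-oo] when S is empty. *)
Definition euclidean_diam S : \bar R :=
  ereal_sup [set (euclidean_dist x y)%:E | x in S & y in S].

(* For beta = 0 a nonempty set has weight 1 (as [0 `^ 0 = 1]) and the empty set
   has weight 0, so that the 0-dimensional measure is the counting measure. *)
Definition hausdorff_gauge beta S : \bar R :=
  if S == set0 then 0%E else (euclidean_diam S `^ beta)%E.

Definition hausdorff_premeasure beta delta A : \bar R :=
  ereal_inf [set (\sum_(0 <= k <oo) hausdorff_gauge beta (S k))%E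
    | S in [set S : nat -> set 'rV[R]_d |
        A `<=` \bigcup_k S k /\
        forall k, (euclidean_diam (S k) <= delta%:E)%E]].

(* [hausdorff_premeasure beta delta A] increases as delta decreases to 0, hence
   its limit at [0^'+] is a supremum. *)
Definition hausdorff_measure beta A : \bar R :=
  if beta < 0 then +oo%E
  else ereal_sup [set hausdorff_premeasure beta delta A | delta in `]0, +oo[].

End HausdorffMeasure.

Section RandomFields.
Context {R : realType}.

Definition spacetime : set (R * R) := `[0, +oo[ `*` setT.

(* Real-valued random fields on [spacetime] are families of random variables
   indexed by R * R whose members outside [spacetime] are irrelevant. *)
Definition continuous_field d (Omega : measurableType d)
    (P : probability Omega R) (X : R * R -> {RV P >-> R}) :=
  forall w, {within spacetime, continuous (fun z => X z w)}.

(* The sigma-algebra on paths generated by the evaluations at the points of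
   [spacetime]. *)
Definition path_measurable : set (set (R * R -> R)) :=
  <<s [set C | exists z (B : set R),
         [/\ spacetime z, measurable B & C = [set f | B (f z)]]] >>.

Definition path_event d (Omega : measurableType d)
    (P : probability Omega R) (X : R * R -> {RV P >-> R})
    (C : set (R * R -> R)) : set Omega := [set w | C (fun z => X z w)].

Definition same_law d d' (Omega : measurableType d) (Omega' : measurableType d')
    (P : probability Omega R) (Q : probability Omega' R)
    (X : R * R -> {RV P >-> R}) (Y : R * R -> {RV Q >-> R}) :=
  forall C, path_measurable C -> P (path_event X C) = Q (path_event Y C).

Definition independent_fields d (Omega : measurableType d)
    (P : probability Omega R) (n : nat)
    (X : 'I_n -> R * R -> {RV P >-> R}) :=
  forall (K : {set 'I_n}) (C : 'I_n -> set (R * R -> R)),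
    (forall i, i \in K -> path_measurable (C i)) ->
    P (\bigcap_(i in [set` K]) path_event (X i) (C i)) =
    (\prod_(i in K) P (path_event (X i) (C i)))%E.

Definition has_density d d' (Omega : measurableType d) (E : measurableType d')
    (P : probability Omega R) (mu : {measure set E -> \bar R})
    (X : Omega -> E) (f : E -> R) :=
  [/\ measurable_fun setT X, measurable_fun setT f, forall x, 0 <= f x &
      forall B, measurable B ->
        P (X @^-1` B) = (\int[mu]_(x in B) (f x)%:E)%E].

Definition compact_interval (I : set R) :=
  exists a b : R, a < b /\ I = `[a, b]%classic.

End RandomFields.

(* Main.v *)
Require Import Defs.
From HB Require Import structures.
From mathcomp Require Import all_boot all_order all_algebra.
From mathcomp Require Import all_classical all_reals all_analysis.
From mathcomp Require Import measurable_realfun ring lra.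
Set Implicit Arguments.
Unset Strict Implicit.
Unset Printing Implicit Defensive.
Import Order.TTheory GRing.Theory Num.Theory.
Import numFieldNormedType.Exports.
Local Open Scope classical_set_scope.
Local Open Scope ring_scope.

(* At scale [eta = 2^-n] the rectangle [I `*` J] is covered by about
   [eta^(-1/H1 - 1/H2)] rectangles with corner [z0] and sides [eta^(1/H1)] and
   [eta^(1/H2)].  If [u] comes within [2 eta] of a level [y] on such a rectangle,
   then, writing [u z = u z0 + L z + X z0 * (v z - v z0)], one of the following
   holds: [sup |L| >= eta], which has probability [O(eta)] by Markov's inequality
   with a moment of order [p >= 1 / (alpha - 1)]; [|u z0 - y| = O(eta)], by
   the bounded density of [u z0]; or an oscillation [t >= eta] of [v] pays for
   [|u z0 - y| <= 3 eta + C t], by the Gaussian tail of the joint density.  Hence each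
   coordinate contributes a factor [O(eta)], and by independence [U] hits a ball of
   radius [eta] with probability [O(eta^(d - 1/H1 - 1/H2))].  Summing this over a
   covering of [A] yields the Hausdorff measure. *)

(** * Space-time rectangles, dense sequences and suprema over compact sets *)

Definition dense_seq {X : topologicalType} (K : set X) (s : nat -> X) :=
  (forall n, K (s n)) /\
  (forall z, K z -> forall A, nbhs z A -> exists n, A (s n)).

Definition rectangle {R : realType} (z : R * R) (h k : R) : set (R * R) :=
  `[z.1, z.1 + h] `*` `[z.2, z.2 + k].

Section Rectangles.
Context {R : realType}.
Implicit Types (z : R * R) (h k : R).

Lemma rectangle_corner z h k : 0 <= h -> 0 <= k -> rectangle z h k z.
Proof.
by move=> h0 k0; split; rewrite /= in_itv/= lexx lerDl.
Qed.

Lemma rectangle_compact z h k : compact (rectangle z h k).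
Proof. by apply: compact_setX; exact: segment_compact. Qed.

Lemma rectangle_spacetime z h k : 0 <= z.1 -> rectangle z h k `<=` spacetime.
Proof.
move=> z0 [a b] [] /=; rewrite in_itv/= => /andP[za _] _.
by split => //=; rewrite in_itv/= andbT (le_trans z0).
Qed.

(** Clamping a rational to [[a, b]] does not move it away from any point of the segment. *)
Lemma segment_dense_rat (a b : R) : a <= b -> exists q : rat -> R,
  (forall r, q r \in `[a, b]) /\
  (forall x, x \in `[a, b] -> forall e, 0 < e -> exists r, `|x - q r| < e).
Proof.
move=> ab; exists (fun r => Num.max a (Num.min b (ratr r))); split.
  by move=> r; rewrite in_itv/= le_max lexx/= ge_max ab ge_min lexx.
move=> x; rewrite in_itv/= => /andP[ax xb] e e0.
have [r] := @rat_in_itvoo R (x - e) (x + e) ltac:(lra).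
rewrite in_itv/= => /andP[r1 r2]; exists r.
rewrite ltr_norml; apply/andP; split.
  by rewrite ltrBrDr addrC -ltrBrDr opprK gt_max gt_min r2 addrC; lra.
rewrite ltrBlDr -ltrBlDl lt_max lt_min; case: (ltP (x - e) a) => //= h.
by apply/andP; split; lra.
Qed.

Lemma rectangle_dense_seq z h k : 0 <= h -> 0 <= k ->
  exists s, dense_seq (rectangle z h k) s.
Proof.
move=> h0 k0.
have [q [qP qD]] := @segment_dense_rat z.1 (z.1 + h) ltac:(by rewrite lerDl).
have [q' [q'P q'D]] := @segment_dense_rat z.2 (z.2 + k) ltac:(by rewrite lerDl).
pose s n := if unpickle n is Some rr then (q rr.1, q' rr.2) else z.
exists s; split.
  move=> n; rewrite /s; case: unpickle => [rr|]; last exact: rectangle_corner.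
  by split; [exact: qP|exact: q'P].
move=> x [/= x1 x2] A /nbhs_ballP[e /= e0 eA].
have [r hr] := qD _ x1 _ e0; have [r' hr'] := q'D _ x2 _ e0.
by exists (pickle (r, r')); apply: eA; rewrite /s pickleK.
Qed.

(** Finitely many neighbourhoods intersect in one, so a single index serves all [f i]. Continuity is
    relative to [S], which contains the sequence. *)
Lemma dense_seq_near (X : topologicalType) (K S : set X) (s : nat -> X) (I : finType)
  (f : I -> X -> R) (x : X) (e : R) : dense_seq K s -> K `<=` S -> K x ->
  (forall i, {within S, continuous (f i)}) -> 0 < e ->
  exists n, forall i, `|f i x - f i (s n)| < e.
Proof.
move=> [sK sD] KS Kx fc e0.
have : \forall y \near within S (nbhs x), forall i, `|f i x - f i y| < e.
  apply: filter_forall => i.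
  have /subspace_continuousP/(_ _ (KS _ Kx)) := fc i.
  by move=> /cvgr_dist_lt /(_ _ e0).
rewrite near_withinE => /(sD _ Kx)[n /= hn]; exists n; apply: hn; exact/KS/sK.
Qed.

Lemma continuous_image_bounds (X : topologicalType) (K S : set X) (f : X -> R) :
  K `<=` S -> K !=set0 -> compact K -> {within S, continuous f} ->
  exists m M, forall x, K x -> m <= f x <= M.
Proof.
move=> KS K0 cK fc; have fK := continuous_subspaceW KS fc.
have [a _ ha] := compact_EVT_min K0 cK fK.
have [b _ hb] := compact_EVT_max K0 cK fK.
by exists (f a), (f b) => x Kx; rewrite ha ?hb// inE.
Qed.

Lemma le_sup_compact (X : topologicalType) (K S : set X) (f : X -> R) (x : X) :
  K `<=` S -> compact K -> {within S, continuous f} -> K x ->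
  f x <= sup [set f z | z in K].
Proof.
move=> KS cK fc Kx; apply: ub_le_sup; last by exists x.
have [|m [M mM]] := continuous_image_bounds KS _ cK fc; first by exists x.
by exists M => _ [z /mM/andP[_ +] <-].
Qed.

End Rectangles.

(** * Measurability of suprema and elementary probability bounds *)

Section MeasureBounds.
Context {R : realType} {d : measure_display} {Omega : measurableType d}.
Variable P : probability Omega R.

(** By continuity the supremum exceeds [x] exactly when some [g (s n)] does, so its superlevel sets
    are countable unions. *)
Lemma measurable_fun_sup_dense (X : topologicalType) (K S : set X) (s : nat -> X)
    (g : X -> Omega -> R) :
  dense_seq K s -> K `<=` S -> compact K ->
  (forall w, {within S, continuous (g ^~ w)}) ->
  (forall z, K z -> measurable_fun setT (g z)) ->
  measurable_fun setT (fun w => sup [set g z w | z in K]).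
Proof.
move=> sD KS cK gc mg.
have K0 : K !=set0 by exists (s 0%N); exact: sD.1.
apply: (measurability _ (RGenOInfty.measurableE R)) => //.
move=> _ [_ [x ->] <-]; rewrite setTI.
rewrite (_ : _ @^-1` _ = \bigcup_n (g (s n) @^-1` `]x, +oo[)).
  apply: bigcupT_measurable => n; rewrite -[X in measurable X]setTI.
  by apply: mg => //; exact: sD.1.
apply/seteqP; split=> w /=; rewrite in_itv/= andbT => h.
  have gK0 : [set g z w | z in K] !=set0 by case: K0 => z Kz; exists (g z w), z.
  have [_ [z Kz <-] xz] := sup_gt gK0 h.
  have [n /(_ tt) hn] := @dense_seq_near _ _ K S s unit (fun=> g ^~ w) z
    (g z w - x) sD KS Kz (fun=> gc w) ltac:(by rewrite subr_gt0).
  exists n => //=; rewrite in_itv/= andbT.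
  by move: hn; rewrite ltr_norml => /andP[_]; rewrite ltrD2l ltrN2.
case: h => n _ /=; rewrite in_itv/= andbT => /lt_le_trans; apply.
by apply: le_sup_compact KS cK (gc w) (sD.1 n).
Qed.

Lemma density_le d' (E : measurableType d') (mu : {measure set E -> \bar R})
    (X : Omega -> E) (f : E -> R) (B : set E) (b m : R) :
  has_density P mu X f -> measurable B -> mu B = m%:E -> 0 <= b ->
  (forall x, B x -> f x <= b) -> (P (X @^-1` B) <= (b * m)%:E)%E.
Proof.
move=> [mX mf f0 Pf] mB muB b0 fb; rewrite Pf// EFinM -muB -integral_cst//.
apply: ge0_le_integral => //.
- by move=> x _; rewrite lee_fin.
- by apply/measurable_EFinP; exact: measurable_funTS.
Qed.

Lemma markov_exprn (X : Omega -> R) (eta : R) (p : nat) :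
  measurable_fun setT X -> (forall w, 0 <= X w) -> 0 <= eta ->
  ((eta ^+ p)%:E * P [set w | (eta <= X w)%R] <= 'E_P[fun w => (X w ^+ p)%R])%E.
Proof.
move=> mX X0 eta0.
have mA : measurable [set w | eta <= X w].
  rewrite -[X in measurable X]setTI; rewrite (_ : [set w | _] = X @^-1` `[eta, +oo[).
    exact: mX.
  by apply/seteqP; split=> w /=; rewrite in_itv/= andbT.
have mXp : measurable_fun setT (fun w => (X w ^+ p)%:E).
  by apply/measurable_EFinP; exact: measurable_funX.
rewrite -integral_cst// unlock.
apply: (@le_trans _ _ (\int[P]_(w in [set w | (eta <= X w)%R]) (X w ^+ p)%:E)%E).
  apply: ge0_le_integral => //.
  - by move=> x _; rewrite lee_fin exprn_ge0.
  - exact: measurable_funTS.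
  - by move=> x /= ex; rewrite lee_fin lerXn2r// nnegrE.
apply: ge0_subset_integral => //.
by move=> x _; rewrite lee_fin exprn_ge0.
Qed.

(** The partial sums of the bounds telescope to [b] times a number at most 1. *)
Lemma telescoping_union_le (F : nat -> set Omega) (b : R) :
  (forall k, measurable (F k)) ->
  (forall k, (P (F k) <= (b * (k.+1%:R^-1 - k.+2%:R^-1))%:E)%E) ->
  (P (\bigcup_k F k) <= b%:E)%E.
Proof.
move=> mF PF.
have b0 : 0 <= b.
  have := le_trans (measure_ge0 P _) (PF 0%N); rewrite lee_fin.
  by rewrite pmulr_lge0// subr_gt0 ltf_pV2 ?posrE// ltr_nat.
have mU : measurable (\bigcup_k F k) by exact: bigcupT_measurable.
apply: le_trans (measure_sigma_subadditive P mF mU (fun _ => id)) _.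
apply: lime_le; first by apply: is_cvg_nneseries => n _ _; exact: measure_ge0.
apply: nearW => n.
apply: (@le_trans _ _ (\sum_(0 <= k < n) (b * (k.+1%:R^-1 - k.+2%:R^-1))%:E)%E).
  by apply: lee_sum => k _; exact: PF.
rewrite sumEFin lee_fin -mulr_sumr -[leRHS]mulr1 ler_wpM2l//.
rewrite (telescope_sumr_eq (fun k => - k.+1%:R^-1))//; last first.
  by move=> k _; rewrite opprK addrC.
by rewrite opprK invr1 addrC lerBlDr lerDl invr_ge0.
Qed.

(** Squaring [1 + x / 2 <= expR (x / 2)] gives [x ^+ 2 / 4 <= expR x]. *)
Lemma expRN_le (x : R) : 0 < x -> expR (- x) <= 4 / x ^+ 2.
Proof.
move=> x0; rewrite expRN -[4]invrK -invfM lef_pV2 ?posrE ?expR_gt0//; last first.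
  by rewrite mulr_gt0 ?exprn_gt0// invr_gt0.
have := expR_ge1Dx (x / 2).
rewrite (_ : expR x = expR (x / 2) * expR (x / 2)) => [h|];
  last by rewrite -expRD -splitr.
by nra.
Qed.

End MeasureBounds.

(** * Coming near a level, and the Gaussian tail of the oscillation *)

Section NearHit.
Context {R : realType}.

(* For a continuous field and [s] dense in a rectangle, this path-measurable event
   contains the event that the field comes within less than [e] of [y] on the
   rectangle. *)
Definition near_hit (s : nat -> R * R) (y e : R) : set (R * R -> R) :=
  \bigcup_n [set f | `|f (s n) - y| < e].

Lemma near_hit_path_measurable s y e : (forall n, spacetime (s n)) ->
  path_measurable (near_hit s y e).
Proof.
move=> sS C [[C0 CD CU] GC]; apply: CU => n; apply: GC.
exists (s n), (ball y e); split => //; first exact: measurable_ball.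
by apply/seteqP; split=> f /=; rewrite /ball/= distrC.
Qed.

Context {d : measure_display} {Omega : measurableType d}.
Variable P : probability Omega R.

Lemma measurable_near_hit (u : R * R -> {RV P >-> R}) s y e :
  measurable (path_event u (near_hit s y e)).
Proof.
rewrite (_ : path_event _ _ = \bigcup_n (u (s n) @^-1` ball y e)); last first.
  by apply/seteqP; split=> w [n _ h]; exists n => //; move: h; rewrite /ball/= distrC.
apply: bigcupT_measurable => n; rewrite -[X in measurable X]setTI.
by apply: measurable_funP => //; exact: measurable_ball.
Qed.

(* Cutting [eta, +oo[ into the intervals [k eta, (k + 1) eta] bounds the event by
   preimages of rectangles, whose probabilities are summable because
   [expR (- t) <= 4 / t ^+ 2] makes the k-th one [O(eta / k ^ 3)]. *)
Lemma gaussian_tail (Y S : Omega -> R) (p : R * R -> R) (c C eta y : R) :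
  0 < c -> 0 <= C -> 0 < eta ->
  has_density P (lebesgue_measure \x lebesgue_measure)%E
    (fun w => (Y w, S w)) p ->
  (forall z1 z2, eta <= z2 ->
     p (z1, z2) <= c / eta * expR (- (z2 ^+ 2 / (c * eta ^+ 2)))) ->
  exists F, [/\ measurable F, (P F <= (16 * c ^+ 3 * (3 + 2 * C) * eta)%:E)%E &
    forall w, eta <= S w -> `|Y w - y| <= 3 * eta + C * S w -> F w].
Proof.
move=> c0 C0 eta0 Yp pb.
(* On the [k]-th slab [S w <= k.+2%:R * eta], so [r k] dominates [3 * eta + C * S w]. *)
pose r (k : nat) := (3 + C * k.+2%:R) * eta.
have r0 k : 0 <= r k by rewrite mulr_ge0 ?addr_ge0 ?mulr_ge0// ltW.
pose B (k : nat) : set (R * R) :=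
  `[y - r k, y + r k]%classic `*` `[k.+1%:R * eta, k.+2%:R * eta]%classic.
have mB k : measurable (B k) by apply: measurableX; exact: measurable_itv.
have [mYS _ _ _] := Yp.
exists (\bigcup_k ((fun w => (Y w, S w)) @^-1` B k)).
have mF k : measurable ((fun w => (Y w, S w)) @^-1` B k).
  by rewrite -[X in measurable X]setTI; apply: mYS => //; exact: mB.
split; first exact: bigcupT_measurable.
- apply: telescoping_union_le => // k.
  set a : R := k.+1%:R.
  have a1 : 1 <= a by rewrite ler1n.
  have a0 : 0 < a by rewrite ltr0n.
  have ka : k.+2%:R = a + 1 :> R by rewrite natr1.
  have pB x : B k x -> p x <= c / eta * (4 / (a ^+ 2 / c) ^+ 2).
    case: x => x1 x2 [_ /=]; rewrite in_itv/= => /andP[kx _].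
    have ex : eta <= x2 by apply: le_trans kx; rewrite ler_peMl// ltW.
    apply: le_trans (pb _ _ ex) _; rewrite ler_pM2l ?divr_gt0//.
    apply: le_trans (expRN_le _); last by rewrite divr_gt0// exprn_gt0.
    rewrite ler_expR lerN2.
    rewrite (_ : a ^+ 2 / c = (a * eta) ^+ 2 / (c * eta ^+ 2)); last first.
      by field; rewrite !gt_eqF.
    rewrite ler_pM2r ?invr_gt0 ?mulr_gt0 ?exprn_gt0//.
    by rewrite lerXn2r// nnegrE ?(le_trans _ ex)// ?mulr_ge0// ltW.
  have muB : (lebesgue_measure \x lebesgue_measure)%E (B k) = (2 * r k * eta)%:E.
    transitivity ((lebesgue_measure `[(y - r k)%R, (y + r k)%R]%classic *
      lebesgue_measure `[(a * eta)%R, (k.+2%:R * eta)%R]%classic)%E).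
      by apply: product_measure1E; exact: measurable_itv.
    rewrite !lebesgue_measure_itv/= !lte_fin.
    have -> : y - r k < y + r k.
      by rewrite ltrD2l gtrN// /r mulr_gt0// ltr_wpDr// ?mulr_ge0.
    have -> : a * eta < k.+2%:R * eta by rewrite ltr_pM2r// ltr_nat.
    rewrite -!EFinB -!EFinM ka; congr _%:E; ring.
  apply: le_trans (density_le Yp (mB k) muB _ pB) _.
    by rewrite mulr_ge0 ?divr_ge0 ?exprn_ge0 ?divr_ge0 ?exprn_ge0// ltW.
  rewrite lee_fin /r ka.
  have ca : 0 < a + 1 by rewrite addr_gt0.
  (* Clearing denominators leaves [(3 + C * (a + 1)) * (a + 1) <= 2 * (3 + 2 * C) * a ^+ 3], which
     follows from [a + 1 <= 2 * a] and [1 <= a]. *)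
  rewrite -subr_ge0 (_ : _ - _ = 8 * c ^+ 3 * eta / (a ^+ 4 * (a + 1)) *
    (2 * (3 + 2 * C) * a ^+ 3 - (3 + C * (a + 1)) * (a + 1))); last first.
    by field; rewrite !gt_eqF.
  rewrite mulr_ge0//.
    by rewrite divr_ge0// !mulr_ge0 ?exprn_ge0// ltW.
  rewrite subr_ge0 (@le_trans _ _ ((3 + 2 * C) * a * (2 * a)))//.
    by rewrite ler_pM//; nra.
  rewrite -subr_ge0 (_ : _ - _ = 2 * (3 + 2 * C) * a ^+ 2 * (a - 1)); last by ring.
  by rewrite !mulr_ge0 ?subr_ge0 ?exprn_ge0 ?addr_ge0 ?mulr_ge0// ltW.
move=> w eS YS.
have Se1 : 1 <= S w / eta by rewrite ler_pdivlMr// mul1r.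
have /Num.Theory.trunc_itv/andP[t1 t2] : 0 <= S w / eta by rewrite (le_trans _ Se1).
(* The slab index is this truncation minus one, as slab 0 starts at [eta]. *)
have : (0 < Num.Def.trunc (S w / eta))%N.
  by rewrite lt0n; apply/eqP => t0; move: t2; rewrite t0 ltNge Se1.
case: Num.Def.trunc t1 t2 => // k t1 t2 _; exists k => //.
move: t1 t2; rewrite ler_pdivlMr// ltr_pdivrMr// => t1 t2.
split; rewrite /= in_itv/=; last by rewrite t1 ltW.
move: YS; rewrite ler_norml => /andP[Y1 Y2].
have : 3 * eta + C * S w <= r k.
  by rewrite /r [in leRHS]mulrDl lerD2l -mulrA ler_wpM2l// ltW.
by move=> hr; apply/andP; split; lra.
Qed.

End NearHit.

(** * One coordinate on one rectangle *)

Section NearHitProbability.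
Context {R : realType} {d : measure_display} {Omega : measurableType d}.
Variable P : probability Omega R.

(** A union bound: [D] comes from Markov's inequality, [Kf * (2 * (3 + C))] from the density of
    [u z0] on an interval around [y], and [32] from two Gaussian tails with constant [16]. *)
Lemma near_hit_le (u v : R * R -> {RV P >-> R}) (X : {RV P >-> R})
    (z0 : R * R) (h k C D Kf c eta y : R) (p : nat) (s : nat -> R * R)
    (f : R -> R) (p_plus p_minus : R * R -> R) :
  let S := rectangle z0 h k in
  continuous_field u -> continuous_field v ->
  0 <= z0.1 -> 0 <= h -> 0 <= k -> 0 <= C -> 0 <= D -> 0 <= Kf -> 0 < c ->
  0 < eta -> (forall n, S (s n)) ->
  {ae P, forall w, `|X w| <= C} ->
  ('E_P[fun w => (sup [set `|u z w - u z0 w - X w * (v z w - v z0 w)|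
     | z in S] ^+ p)%R] <= (D * eta ^+ p.+1)%:E)%E ->
  has_density P lebesgue_measure (u z0) f ->
  (forall x, `|x - y| <= (3 + C) * eta -> f x <= Kf) ->
  has_density P (lebesgue_measure \x lebesgue_measure)%E
    (fun w => (u z0 w, sup [set v z w - v z0 w | z in S])) p_plus ->
  has_density P (lebesgue_measure \x lebesgue_measure)%E
    (fun w => (- u z0 w, sup [set - v z w + v z0 w | z in S])) p_minus ->
  (forall z1 z2, eta <= z2 ->
    p_plus (z1, z2) <= c / eta * expR (- (z2 ^+ 2 / (c * eta ^+ 2)))) ->
  (forall z1 z2, eta <= z2 ->
    p_minus (z1, z2) <= c / eta * expR (- (z2 ^+ 2 / (c * eta ^+ 2)))) ->
  (P (path_event u (near_hit s y (2 * eta))) <=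
    ((D + Kf * (2 * (3 + C)) + 32 * c ^+ 3 * (3 + 2 * C)) * eta)%:E)%E.
Proof.
move=> S uc vc z00 h0 k0 C0 D0 Kf0 c0 eta0 sS [N [mN PN NX]] EX uf fK up um pp pm.
have SS : S `<=` spacetime by exact: rectangle_spacetime.
have cS : compact S by exact: rectangle_compact.
(* The sequence [s] is only assumed to lie in [S]; measurability of the supremum needs a dense
   one. *)
have [q qD] := rectangle_dense_seq z0 h0 k0.
pose L z w := `|u z w - u z0 w - X w * (v z w - v z0 w)|.
have Lc w : {within spacetime, continuous (L ^~ w)}.
  move=> x; apply: cvg_norm; apply: cvgB.
    by apply: cvgB; [exact: uc|exact: cvg_cst].
  by apply: cvgMr; apply: cvgB; [exact: vc|exact: cvg_cst].
have mL z : measurable_fun setT (L z).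
  apply: measurableT_comp => //; apply: measurable_funB; first exact: measurable_funB.
  by apply: measurable_funM => //; exact: measurable_funB.
pose Xn w := sup [set L z w | z in S].
have mXn : measurable_fun setT Xn by apply: (measurable_fun_sup_dense qD SS cS).
have LX z w : S z -> L z w <= Xn w by exact: (le_sup_compact SS cS (Lc w)).
have Xn0 w : 0 <= Xn w by apply: le_trans (LX _ _ (sS 0%N)); exact: normr_ge0.
pose A1 := [set w | eta <= Xn w].
have mA1 : measurable A1.
  rewrite (_ : A1 = setT `&` Xn @^-1` `[eta, +oo[); first exact: mXn.
  by rewrite setTI; apply/seteqP; split=> w /=; rewrite in_itv/= andbT.
have PA1 : (P A1 <= (D * eta)%:E)%E.
  have etap : 0 < eta ^+ p by rewrite exprn_gt0.
  (* Markov's inequality consumes [p] of the [p.+1] powers of [eta] in the moment bound. *)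
  rewrite -(@lee_pmul2l _ (eta ^+ p)%:E)// -EFinM mulrCA -exprSr.
  exact: le_trans (markov_exprn P p mXn Xn0 (ltW eta0)) EX.
pose B : set R := `[y - (3 + C) * eta, y + (3 + C) * eta]%classic.
have mB : measurable B by exact: measurable_itv.
pose A2 := u z0 @^-1` B.
have mA2 : measurable A2 by rewrite -[A2]setTI; exact: measurable_funP.
have PA2 : (P A2 <= (Kf * (2 * (3 + C) * eta))%:E)%E.
  have muB : lebesgue_measure B = (2 * (3 + C) * eta)%:E.
    rewrite /B lebesgue_measure_itv/= lte_fin -EFinB.
    rewrite ltrD2l gtrN; last by rewrite mulr_gt0// ltr_wpDr.
    by congr _%:E; ring.
  apply: (density_le uf mB muB) => //.
  move=> x; rewrite /B /= in_itv/= => /andP[x1 x2]; apply: fK.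
  by rewrite ler_norml; apply/andP; split; lra.
have [Fp [mFp PFp Fph]] := gaussian_tail y c0 C0 eta0 up pp.
have [Fm [mFm PFm Fmh]] := gaussian_tail (- y) c0 C0 eta0 um pm.
have sub : path_event u (near_hit s y (2 * eta)) `<=`
    N `|` A1 `|` A2 `|` Fp `|` Fm.
  move=> w [n _ /= hn].
  have [Nw|NNw] := pselect (N w); first by do 4 left.
  have Xw : `|X w| <= C by apply: contrapT => /NX.
  have [A1w|nA1] := lerP eta (Xn w); first by do 3 left; right.
  set z := s n in hn; have Sz : S z := sS n.
  set m1 := sup [set v z w - v z0 w | z in S].
  set m2 := sup [set - v z w + v z0 w | z in S].
  have v1 : v z w - v z0 w <= m1.
    apply: (le_sup_compact (f := fun z => v z w - v z0 w) SS cS _ Sz).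
    by move=> x; apply: cvgB; [exact: vc|exact: cvg_cst].
  have v2 : - v z w + v z0 w <= m2.
    apply: (le_sup_compact (f := fun z => - v z w + v z0 w) SS cS _ Sz).
    by move=> x; apply: cvgD; [apply: cvgN; exact: vc|exact: cvg_cst].
  (* Triangle inequality: [2 * eta] from the near hit, [eta] from [L], and [C * m] from the
     oscillation of [v]. *)
  have vm m : m1 <= m -> m2 <= m -> `|u z0 w - y| <= 3 * eta + C * m.
    move=> m1m m2m.
    have vd : `|v z w - v z0 w| <= m by rewrite ler_norml; apply/andP; split; lra.
    have Lz : L z w <= eta by rewrite (le_trans (LX _ _ Sz))// ltW.
    have Xv : `|X w * (v z w - v z0 w)| <= C * m by rewrite normrM ler_pM.
    move: hn Lz Xv; rewrite /L ltr_norml !ler_norml.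
    move=> /andP[? ?] /andP[? ?] /andP[? ?]; apply/andP; split; lra.
  have small : m1 < eta -> m2 < eta -> A2 w.
    move=> /ltW e1 /ltW e2; have := vm _ e1 e2.
    rewrite -mulrDl /A2 /B /= in_itv/= ler_norml => /andP[? ?].
    by apply/andP; split; lra.
  (* The larger one-sided supremum bounds the oscillation and selects the joint density; the minus
     sign goes with the level [- y]. *)
  have [m12|/ltW m21] := lerP m1 m2.
    have [e2|e2] := lerP eta m2.
      right; apply: Fmh => //.
      by rewrite -opprD normrN; exact: vm.
    by left; left; right; apply: small => //; exact: le_lt_trans e2.
  have [e1|e1] := lerP eta m1.
    by left; right; apply: Fph => //; exact: vm.
  by left; left; right; apply: small => //; exact: le_lt_trans e1.
have mU : measurable (N `|` A1 `|` A2 `|` Fp `|` Fm) by do !apply: measurableU.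
apply: le_trans (le_measure _ _ _ sub) _; rewrite ?inE//.
  exact: measurable_near_hit.
rewrite (_ : (D + _ + _) * eta = 0 + D * eta + Kf * (2 * (3 + C) * eta) +
  16 * c ^+ 3 * (3 + 2 * C) * eta + 16 * c ^+ 3 * (3 + 2 * C) * eta); last by ring.
rewrite !EFinD.
have PU E F (a b : \bar R) : measurable E -> measurable F ->
    (P E <= a)%E -> (P F <= b)%E -> (P (E `|` F) <= a + b)%E.
  by move=> mE mF PE PF; rewrite (le_trans (measureU2 _ mE mF))// leeD.
have mN1 := measurableU _ _ mN mA1; have mN2 := measurableU _ _ mN1 mA2.
apply: (PU) => //; first exact: measurableU.
by apply: (PU) => //; apply: (PU) => //; apply: (PU) => //; rewrite PN.
Qed.

End NearHitProbability.

(** * Dyadic scales *)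

Section DyadicScales.
Context {R : realType}.

(** A real power, so that raising it to [H1^-1] or [H2^-1] gives the rectangle sides of the moment
    hypothesis. *)
Definition dyadic (n : nat) : R := 2 `^ (- n%:R).

Lemma dyadic_gt0 n : 0 < dyadic n. Proof. exact: powR_gt0. Qed.

Lemma dyadic_exprn n p : dyadic n ^+ p = 2 `^ (- (p%:R * n%:R)).
Proof. by rewrite -powR_mulrn ?powR_ge0// -powRrM mulrC mulrN. Qed.

Lemma dyadicS n : dyadic n = 2 * dyadic n.+1.
Proof.
rewrite /dyadic -[X in X * _](@powRr1 _ 2)// -powRD ?pnatr_eq0 ?implybT//.
by rewrite -(natr1 n) opprD addrCA subrr addr0.
Qed.

Lemma dyadic_le1 n : dyadic n <= 1.
Proof. by rewrite -(powRr0 (2 : R)) ler_powR ?ler1n// oppr_le0. Qed.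

Lemma dyadic_le m n : (m <= n)%N -> dyadic n <= dyadic m.
Proof. by move=> mn; rewrite ler_powR ?ler1n// lerN2 ler_nat. Qed.

Lemma dyadic_small (e : R) : 0 < e -> exists n, dyadic n < e.
Proof.
move=> e0; exists (Num.Def.trunc e^-1); rewrite /dyadic powRN powR_mulrn//.
rewrite invf_plt ?posrE ?exprn_gt0//.
have /Num.Theory.trunc_itv/andP[_ h] : 0 <= e^-1 by rewrite invr_ge0 ltW.
apply: lt_le_trans h _.
by rewrite -natrX ler_nat ltn_expl.
Qed.

(** Take the least [m] with [dyadic m <= r] and step back by one; [m = 0] is impossible because
    [r < 1]. *)
Lemma dyadic_bracket (r : R) N : 0 < r -> r < dyadic N ->
  exists2 n, (N <= n)%N & r < dyadic n <= 2 * r.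
Proof.
move=> r0 rN; have [m mr] := dyadic_small r0.
have hm : exists m, dyadic m <= r by exists m; exact: ltW.
case: (ex_minnP hm) => -[|k] kr kmin.
  move: rN => /lt_le_trans /(_ (dyadic_le1 N)).
  by rewrite ltNge (le_trans _ kr)// /dyadic oppr0 powRr0.
exists k; last first.
  apply/andP; split; last by rewrite dyadicS ler_pM2l.
  by rewrite ltNge; apply/negP => /kmin; rewrite ltnn.
rewrite leqNgt; apply/negP => /dyadic_le /le_trans /(_ kr).
by rewrite leNgt rN.
Qed.

End DyadicScales.

(** * Uniformity in the corner, the level and the scale *)

Section UniformBound.
Context {R : realType} {dO : measure_display} {Omega : measurableType dO}.
Variable P : probability Omega R.

Lemma near_hit_uniform (u v : R * R -> {RV P >-> R})
  (u_cont : continuous_field u) (v_cont : continuous_field v)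
  (T : R) (I J : set R) (I_sub : I `<=` `]0, T])
  (C : R) (C_ge0 : 0 <= C) (X : R * R -> {RV P >-> R})
  (X_bound : forall z0, (I `*` J) z0 -> {ae P, forall w, `|X z0 w| <= C})
  (H1 H2 alpha : R) (alpha_gt1 : 1 < alpha)
  (hyp1 : \forall p \near \oo, exists C_Tp : R, \forall n \near \oo,
     forall z0, (I `*` J) z0 ->
     let L z w := u z w - u z0 w - X z0 w * (v z w - v z0 w) in
     let Xn w := sup [set `|L z w| | z in
       `[z0.1, z0.1 + 2 `^ (- (n%:R * H1^-1))] `*`
       `[z0.2, z0.2 + 2 `^ (- (n%:R * H2^-1))]] in
     ('E_P[fun w => (Xn w ^+ p)%R] <=
       (C_Tp * 2 `^ (- (alpha * p%:R * n%:R)))%R%:E)%E)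
  (hyp2 : exists pdf : R * R -> R -> R,
     (forall z, (I `*` J) z -> has_density P lebesgue_measure (u z) (pdf z)) /\
     forall M : R, 0 <= M -> exists K : R, forall z y,
       (I `*` J) z -> y \in `[- M, M] -> pdf z y <= K)
  (hyp3 : exists2 c : R, 0 < c & \forall eta \near 0^'+,
     forall z0, (I `*` J) z0 ->
     let S := `[z0.1, z0.1 + eta `^ H1^-1] `*` `[z0.2, z0.2 + eta `^ H2^-1] in
     exists p_plus p_minus : R * R -> R,
     [/\ has_density P (lebesgue_measure \x lebesgue_measure)%E
           (fun w => (u z0 w, sup [set v z w - v z0 w | z in S])) p_plus,
         has_density P (lebesgue_measure \x lebesgue_measure)%E
           (fun w => (- u z0 w, sup [set - v z w + v z0 w | z in S])) p_minus &
         forall z1 z2, eta <= z2 ->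
           p_plus (z1, z2) <= c / eta * expR (- (z2 ^+ 2 / (c * eta ^+ 2))) /\
           p_minus (z1, z2) <= c / eta * expR (- (z2 ^+ 2 / (c * eta ^+ 2)))])
  (M : R) : 0 < M ->
  exists K, 0 <= K /\ exists N, forall n, (N <= n)%N ->
    forall z0, (I `*` J) z0 -> forall y, `|y| <= M -> forall s,
    (forall k, rectangle z0 (dyadic n `^ H1^-1) (dyadic n `^ H2^-1) (s k)) ->
    (P (path_event u (near_hit s y (2 * dyadic n))) <= (K * dyadic n)%:E)%E.
Proof.
move=> M0.
case: hyp1 => p0 _ h1; case: hyp2 => pdf [fu fb]; case: hyp3 => c c0 [del /= del0 h3].
(* A moment of order [p > (alpha - 1)^-1] has [alpha * p >= p + 1], hence the bound [eta ^+ p.+1]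
   required by [near_hit_le]. *)
pose p := maxn p0 (Num.Def.trunc (alpha - 1)^-1).+1.
have pa : p%:R + 1 <= alpha * p%:R.
  have a1 : 0 < alpha - 1 by rewrite subr_gt0.
  have : (alpha - 1)^-1 < p%:R.
    have /Num.Theory.trunc_itv/andP[_ h] : 0 <= (alpha - 1)^-1 by rewrite invr_ge0 ltW.
    by apply: lt_le_trans h _; rewrite ler_nat leq_maxr.
  rewrite -div1r ltr_pdivrMr// => h; lra.
have [D [n0 _ hD]] := h1 p (leq_maxl _ _).
(* Since [eta <= 1], this window contains every point within [(3 + C) * eta] of a level [y] with
   [|y| <= M]. *)
have [K0 K0P] := fb (M + (3 + C)) ltac:(by rewrite !addr_ge0// ltW).
have [n1 n1P] := dyadic_small del0.
(* The constants supplied by the hypotheses carry no sign. *)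
pose D' := Num.max D 0; pose Kf := Num.max K0 0.
exists (D' + Kf * (2 * (3 + C)) + 32 * c ^+ 3 * (3 + 2 * C)); split.
  by rewrite !addr_ge0 ?mulr_ge0 ?addr_ge0 ?exprn_ge0 ?mulr_ge0 ?le_max
    ?lexx ?orbT// ltW.
exists (maxn n0 n1) => n; rewrite geq_max => /andP[nn0 nn1] z0 zIJ y yM s sS.
have eta0 : 0 < dyadic n :> R by exact: dyadic_gt0.
have eta_small : ball 0 del (dyadic n).
  have dn := le_lt_trans (dyadic_le nn1) n1P.
  by rewrite /ball/= sub0r normrN gtr0_norm.
have [pp [pm [dp dm ppm]]] := h3 _ eta_small eta0 _ zIJ.
have z00 : 0 <= z0.1.
  by have /I_sub/= := zIJ.1; rewrite in_itv/= => /andP[/ltW].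
apply: (near_hit_le (p := p) u_cont v_cont z00 _ _ C_ge0 _ _ c0 eta0 sS
  (X_bound _ zIJ) _ (fu _ zIJ) _ dp dm) => //; rewrite ?powR_ge0 ?le_max ?lexx ?orbT//.
- have := hD n nn0 z0 zIJ => /=; rewrite /rectangle.
  rewrite /dyadic -!powRrM !mulNr => /le_trans; apply; rewrite lee_fin.
  rewrite -/(dyadic n) dyadic_exprn.
  apply: (@le_trans _ _ (D' * 2 `^ (- (alpha * p%:R * n%:R)))).
    by rewrite ler_wpM2r ?powR_ge0// le_max lexx.
  rewrite ler_wpM2l ?le_max ?lexx ?orbT// ler_powR ?ler1n// lerN2.
  by rewrite ler_wpM2r// -(natr1 p).
- move=> x xy; rewrite le_max; apply/orP; left; apply: K0P => //.
  rewrite in_itv/= -ler_norml -[x](subrK y) addrC.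
  rewrite (le_trans (ler_normD _ _))// lerD// (le_trans xy)//.
  by rewrite ler_piMr ?dyadic_le1// addr_ge0.
- by move=> z1 z2 /(ppm z1)[].
- by move=> z1 z2 /(ppm z1)[].
Qed.

End UniformBound.

(** * All coordinates near the centre of a small ball *)

Section BallHitting.
Context {R : realType}.

(** The last cell may stick out beyond [b], but all corners stay in [[a, b]], where the estimates
    are available. [h <= 1] absorbs the extra node in the count. *)
Lemma segment_grid (a b h : R) : a <= b -> 0 < h <= 1 -> exists m : nat,
  [/\ m%:R <= (b - a + 1) / h, forall i, (i < m)%N -> a + i%:R * h \in `[a, b] &
   forall x, x \in `[a, b] ->
     exists2 i, (i < m)%N & a + i%:R * h <= x <= a + i%:R * h + h].
Proof.
move=> ab /andP[h0 h1].
have tr (x : R) : a <= x -> 0 <= (x - a) / h.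
  by move=> ?; rewrite divr_ge0 ?subr_ge0// ltW.
have /Num.Theory.trunc_itv/andP[] := tr _ ab.
set m := Num.Def.trunc _ => t1 t2; exists m.+1; split.
- rewrite -(natr1 m) [leRHS]mulrDl lerD// ler_pdivlMr// mul1r; exact: h1.
- move=> i; rewrite ltnS => im; rewrite in_itv/= lerDl mulr_ge0 ?(ltW h0)//=.
  by rewrite -lerBrDl -ler_pdivlMr// (le_trans _ t1)// ler_nat.
move=> x; rewrite in_itv/= => /andP[ax xb].
have /Num.Theory.trunc_itv/andP[] := tr _ ax.
set i := Num.Def.trunc _ => i1 i2; exists i.
  rewrite -(ltr_nat R) (le_lt_trans i1)// (le_lt_trans _ t2)// ler_pM2r ?invr_gt0//.
  by rewrite lerD2r.
move: i1 i2; rewrite ler_pdivlMr// ltr_pdivrMr// -(natr1 i) mulrDl mul1r => i1 i2.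
by apply/andP; split; lra.
Qed.

Context {d d' : measure_display} {Omega : measurableType d}
  {Omega' : measurableType d'}.
Variables (P : probability Omega R) (Q : probability Omega' R).

Lemma measure_bigsetU_le (I : Type) (r : seq I) (F : I -> set Omega') (b : R) :
  (forall i, measurable (F i)) -> (forall i, (Q (F i) <= b%:E)%E) ->
  (Q (\big[setU/set0]_(i <- r) F i) <= ((size r)%:R * b)%:E)%E.
Proof.
move=> mF Fb; elim: r => [|i r IH]; first by rewrite big_nil measure0 mul0r.
rewrite big_cons; have mr : measurable (\big[setU/set0]_(j <- r) F j).
  by apply: bigsetU_measurable.
rewrite (le_trans (measureU2 _ (mF i) mr))//= -natr1 mulrDl mul1r addrC EFinD.
exact: leeD.
Qed.

(** Independence factorizes the probability, and equality in law moves each factor from [Q] to [P];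
    both apply to path-measurable sets. *)
Lemma independent_fields_le (n : nat) (u : R * R -> {RV P >-> R})
    (U : 'I_n -> R * R -> {RV Q >-> R}) (C : 'I_n -> set (R * R -> R)) (b : R) :
  independent_fields U -> (forall i, same_law (U i) u) ->
  (forall i, path_measurable (C i)) ->
  (forall i, (P (path_event u (C i)) <= b%:E)%E) ->
  (Q (\bigcap_i path_event (U i) (C i)) <= (b ^+ n)%:E)%E.
Proof.
move=> Ui Ul mC Cb; have := Ui [set: 'I_n]%SET C (fun i _ => mC i).
rewrite (_ : [set` _] = setT); last by apply/seteqP; split=> i //=; rewrite inE.
move=> ->; rewrite -[n in leRHS]card_ord -cardsT -prodr_const.
(* Nonnegativity is carried along so that the bounds can be multiplied. *)
pose rel (x : \bar R) (y : R) := (0 <= x <= y%:E)%E.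
suff : rel (\prod_(i in [set: 'I_n]%SET) Q (path_event (U i) (C i)))%E
    (\prod_(i in [set: 'I_n]%SET) b) by move=> /andP[].
apply: (big_ind2 rel) => [|x1 x2 y1 y2 /andP[x10 x12] /andP[y10 y12]|i _].
- by rewrite /rel lee01 lexx.
- by rewrite /rel mule_ge0//= EFinM lee_pmul.
- by rewrite /rel measure_ge0/= Ul.
Qed.

(** A union bound over a grid: the number of cells is at most a constant times [dyadic m] to the
    power [- H1^-1 - H2^-1], and each contributes at most [(K * dyadic m) ^+ n]. *)
Lemma ball_hitting (n : nat) (u : R * R -> {RV P >-> R})
    (U : 'I_n -> R * R -> {RV Q >-> R})
    (a b a' b' H1 H2 M K : R) (N : nat) :
  (forall i, continuous_field (U i)) ->
  independent_fields U -> (forall i, same_law (U i) u) ->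
  0 <= a -> a <= b -> a' <= b' -> 0 < H1 -> 0 < H2 -> 0 <= K ->
  (forall m, (N <= m)%N ->
    forall z0, (`[a, b] `*` `[a', b']) z0 -> forall y, `|y| <= M -> forall s,
    (forall k, rectangle z0 (dyadic m `^ H1^-1) (dyadic m `^ H2^-1) (s k)) ->
    (P (path_event u (near_hit s y (2 * dyadic m))) <= (K * dyadic m)%:E)%E) ->
  forall m, (N <= m)%N -> forall x : 'rV[R]_n, (forall i, `|x ord0 i| <= M) ->
  exists G, [/\ measurable G,
    (Q G <= ((b - a + 1) * (b' - a' + 1) * K ^+ n *
       dyadic m `^ (n%:R - H1^-1 - H2^-1))%:E)%E &
    forall w z, (`[a, b] `*` `[a', b']) z ->
      (forall i, `|U i z w - x ord0 i| <= dyadic m) -> G w].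
Proof.
move=> Uc Ui Ul a0 ab ab' H10 H20 K0 hK m Nm x xM.
set e : R := dyadic m; have e0 : 0 < e by exact: dyadic_gt0.
have h01 (H : R) : 0 < H -> 0 < e `^ H^-1 <= 1.
  move=> H0; rewrite powR_gt0//= [leRHS](_ : _ = 1 `^ H^-1); last by rewrite powR1.
  by rewrite ge0_ler_powR ?nnegrE ?invr_ge0 ?dyadic_le1// ltW.
set h := e `^ H1^-1; set k := e `^ H2^-1.
have /andP[h0 h1] := h01 _ H10; have /andP[k0 k1] := h01 _ H20.
rewrite -/h in h0 h1; rewrite -/k in k0 k1.
have [p [pb pI pc]] := segment_grid ab (h01 _ H10).
have [q [qb qJ qc]] := segment_grid ab' (h01 _ H20).
pose z (ij : 'I_p * 'I_q) : R * R := (a + ij.1%:R * h, a' + ij.2%:R * k).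
have zIJ ij : (`[a, b] `*` `[a', b']) (z ij) by split; [exact: pI|exact: qJ].
have z0 ij : 0 <= (z ij).1 by rewrite addr_ge0// mulr_ge0// ltW.
have /choice[s sD] : forall ij, exists s, dense_seq (rectangle (z ij) h k) s.
  by move=> ij; apply: rectangle_dense_seq; exact: ltW.
(* The radius is doubled because passing from a point of the cell to the dense sequence costs less
   than another [e]. *)
pose C ij l := near_hit (s ij) (x ord0 l) (2 * e).
pose E ij := \bigcap_l path_event (U l) (C ij l).
have mE ij : measurable (E ij).
  apply: fin_bigcap_measurable => // l _; exact: measurable_near_hit.
have QE ij : (Q (E ij) <= ((K * e) ^+ n)%:E)%E.
  apply: independent_fields_le Ui Ul _ _.
    move=> l; apply: near_hit_path_measurable => t.
    by apply: (rectangle_spacetime (z0 ij)); exact: (sD ij).1.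
  by move=> l; apply: hK => // t; exact: (sD ij).1.
exists (\big[setU/set0]_(ij <- enum {: 'I_p * 'I_q}) E ij); split.
- exact: bigsetU_measurable.
- apply: le_trans (measure_bigsetU_le _ mE QE) _; rewrite lee_fin.
  rewrite -cardE card_prod !card_ord natrM.
  have -> : e `^ (n%:R - H1^-1 - H2^-1) = e ^+ n / h / k.
    have en0 : e != 0 by rewrite gt_eqF.
    by rewrite !powRD ?en0 ?implybT// !powRN powR_mulrn// ltW.
  rewrite (_ : _ * (e ^+ n / h / k) =
    ((b - a + 1) / h) * ((b' - a' + 1) / k) * (K * e) ^+ n); last first.
    by rewrite exprMn; ring.
  by rewrite ler_wpM2r ?exprn_ge0 ?mulr_ge0 ?(ltW e0)// ler_pM.
- move=> w t [t1 t2] tx.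
  have [i ip /andP[i1 i2]] := pc _ t1; have [j jq /andP[j1 j2]] := qc _ t2.
  pose ij := (Ordinal ip, Ordinal jq).
  rewrite -bigcup_seq; exists ij; first by rewrite /= mem_enum.
  move=> l _.
  have tS : rectangle (z ij) h k t.
    by split; rewrite /= in_itv/= ?i1 ?i2 ?j1 ?j2.
  have [r /(_ tt) hr] := @dense_seq_near _ _ _ _ _ unit (fun=> (U l)^~ w) t e
    (sD ij) (rectangle_spacetime (z0 ij)) tS (fun=> Uc l w) e0.
  exists r => //=; rewrite -(subrK (U l t w) (U l (s ij r) w)) -addrA.
  rewrite (le_lt_trans (ler_normD _ _))// mulr2n mulrDl !mul1r.
  by rewrite ltr_leD// distrC.
Qed.

End BallHitting.

(** * Measurability of the hitting event *)

Section HittingEvent.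
Context {R : realType} {d : measure_display} {Omega : measurableType d}.
Variable Q : probability Omega R.

(** The complement of the closed set [A] contains a sup-norm ball around [y], and a point outside
    that ball is far from [y] in some coordinate. *)
Lemma compact_separated (n : nat) (A : set 'rV[R]_n) (y : 'rV[R]_n) :
  compact A -> ~ A y -> exists2 e : R, 0 < e &
    forall a, A a -> exists i, e <= `|y ord0 i - a ord0 i|.
Proof.
move=> cA nAy.
have : nbhs y (~` A).
  apply: open_nbhs_nbhs; split => //; apply: closed_openC.
  by apply: compact_closed => //; exact: norm_hausdorff.
move=> /nbhs_ballP[e /= e0 eA]; exists e => // a Aa.
apply/not_existsP => h; apply: (eA a) => //; split => // i j.
rewrite ord1 /ball/= ltNge; apply/negP; exact: h.
Qed.

(* A measure is arbitrary on nonmeasurable sets, so monotonicity cannot be applied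
   to the hitting event before it is known to be measurable. *)
Lemma hitting_event_measurable (n : nat) (U : 'I_n -> R * R -> {RV Q >-> R})
    (K : set (R * R)) (s : nat -> R * R) (A : set 'rV[R]_n) :
  (forall i, continuous_field (U i)) -> K `<=` spacetime -> compact K ->
  dense_seq K s -> compact A ->
  measurable [set w | [set \row_(i < n) U i z w | z in K] `&` A !=set0].
Proof.
move=> Uc KS cK sD cA.
(* The rational point [r] mediates between [A] and the value of the field at [s t], which leaves
   only countable operations. *)
pose close m (r : {ffun 'I_n -> rat}) := exists2 a, A a &
  forall i, `|ratr (r i) - a ord0 i| < m.+1%:R^-1.
pose F m t r := [set w | close m r] `&`
  \bigcap_i (U i (s t) @^-1` ball (ratr (r i) : R) m.+1%:R^-1).
rewrite (_ : [set w | _] = \bigcap_m \bigcup_t \bigcup_r F m t r).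
  apply: bigcapT_measurable => m; apply: bigcupT_measurable => t.
  apply: countable_bigcupT_measurable => [|r]; first exact: countableP.
  apply: measurableI.
    by have [h|h] := pselect (close m r);
      [rewrite (_ : [set w | _] = setT)|rewrite (_ : [set w | _] = set0)] => //;
      apply/seteqP; split.
  apply: fin_bigcap_measurable => // i _; rewrite -[X in measurable X]setTI.
  by apply: measurable_funP => //; exact: measurable_ball.
apply/seteqP; split=> w.
  move=> [_ [[z Kz <-] Az]] m _.
  (* Half of the tolerance pays for passing from [z] to [s t], half for rational approximation. *)
  rewrite /F /close [m.+1%:R^-1]splitr.
  have : 0 < m.+1%:R^-1 / 2 :> R by rewrite divr_gt0// invr_gt0.
  move: (_ / 2) => e e0.
  have [t ht] := dense_seq_near sD KS Kz (fun i => Uc i w) e0.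
  have /choice[r rP] : forall i, exists q : rat, `|ratr q - U i z w| < e.
    move=> i; have [q] := @rat_in_itvoo R (U i z w - e) (U i z w + e) ltac:(lra).
    rewrite in_itv/= => /andP[q1 q2]; exists q.
    by rewrite ltr_norml; apply/andP; split; lra.
  exists t => //; exists [ffun i => r i] => //; split.
    exists (\row_i U i z w) => // i; rewrite ffunE mxE (lt_trans (rP i))//.
    by rewrite ltrDl.
  move=> i _; rewrite /ball/= ffunE.
  move: (ht i) (rP i); rewrite !ltr_norml => /andP[? ?] /andP[? ?].
  by apply/andP; split; lra.
(* If the path misses [A], compactness of [K] yields one [N] for which the path on [K] stays at
   sup-distance at least [2 * N.+1%:R^-1] from [A], against [hw N]. *)
move=> hw; apply: contrapT => nhit.
pose far m z := spacetime z ->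
  forall a, A a -> exists i, 2 * m.+1%:R^-1 <= `|U i z w - a ord0 i|.
have /compact_near_coveringP/(_ nat \oo far _) := cK; case.
  move=> z Kz.
  have [|e e0 eA] := @compact_separated n A (\row_i U i z w) cA.
    by move=> Az; apply: nhit; exists (\row_i U i z w); split => //; exists z.
  have e2 : 0 < e / 2 by rewrite divr_gt0.
  have near_z : \forall z' \near z, spacetime z' ->
      forall i, `|U i z w - U i z' w| < e / 2.
    suff : \forall z' \near within spacetime (nbhs z),
      forall i, `|U i z w - U i z' w| < e / 2 by rewrite near_withinE.
    apply: filter_forall => i.
    have /subspace_continuousP/(_ _ (KS _ Kz)) := Uc i w.
    by move=> /cvgr_dist_lt /(_ _ e2).
  have near_m : \forall m \near \oo, 2 * m.+1%:R^-1 < e / 2.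
    have e4 : 0 < e / 4 by rewrite divr_gt0.
    have := near_infty_natSinv_lt (PosNum e4).
    by apply: filterS => m /=; move: m.+1%:R^-1 => t ht; lra.
  exists ([set z' | spacetime z' -> forall i, `|U i z w - U i z' w| < e / 2],
    [set m | 2 * m.+1%:R^-1 < e / 2]) => //.
  move=> [z' m] [/= hz hm] /hz{}hz a /eA[i]; rewrite mxE => ei; exists i.
  move: m.+1%:R^-1 hm (hz i) ei => em hm h1 h2.
  have := ler_normD (U i z w - U i z' w) (U i z' w - a ord0 i).
  by rewrite addrA subrK => h3; lra.
move=> N _ /(_ N (leqnn N)) farN.
have [t _ [r _ [[a Aa ra] Ur]]] := hw N I.
have st := sD.1 t.
have [i] := farN _ st (KS _ st) _ Aa.
move: (ra i) (Ur i I); rewrite /ball/=; move: N.+1%:R^-1 => em h1 h2.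
have := ler_normD (U i (s t) w - ratr (r i)) (ratr (r i) - a ord0 i).
by rewrite addrA subrK [`|U i (s t) w - ratr _|]distrC; lra.
Qed.

End HittingEvent.

(** * From ball estimates to Hausdorff measure *)

Section HausdorffCovering.
Context {R : realType} {n : nat}.

Lemma le_euclidean_dist (x y : 'rV[R]_n) i :
  `|x ord0 i - y ord0 i| <= euclidean_dist x y.
Proof.
rewrite -sqrtr_sqr ler_sqrt ?sumr_ge0// => [|j _]; last exact: sqr_ge0.
by rewrite (bigD1 i)//= lerDl sumr_ge0// => j _; exact: sqr_ge0.
Qed.

(** The point [x] excludes the value [-oo] and the bound excludes [+oo]. The last clause places [S]
    in a sup-norm ball around [x]. *)
Lemma euclidean_diam_fin (S : set 'rV[R]_n) (delta : R) x :
  S x -> (euclidean_diam S <= delta%:E)%E ->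
  exists r, [/\ euclidean_diam S = r%:E, 0 <= r <= delta &
    forall y, S y -> forall i, `|y ord0 i - x ord0 i| <= r].
Proof.
move=> Sx Sd.
have ub y : S y -> ((euclidean_dist y x)%:E <= euclidean_diam S)%E.
  by move=> Sy; apply: ereal_sup_ubound; exists y => //; exists x.
have := ub _ Sx; case E : (euclidean_diam S) Sd ub => [r| |]//.
rewrite !lee_fin => rd ub xr; exists r; split => //.
  by rewrite rd (le_trans _ xr)// sqrtr_ge0.
by move=> y Sy i; rewrite (le_trans (le_euclidean_dist _ _ _))// -lee_fin ub.
Qed.

Context {d : measure_display} {Omega : measurableType d}.
Variable Q : probability Omega R.
(** [V w] abstracts the range of the path of [U] over the space-time rectangle. *)
Variables (beta K M : R) (N : nat) (V : Omega -> set 'rV[R]_n).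
Hypotheses (beta0 : 0 <= beta) (K0 : 0 <= K).
Hypothesis ball_le : forall m, (N <= m)%N -> forall x : 'rV[R]_n,
  (forall i, `|x ord0 i| <= M) ->
  exists G, [/\ measurable G, (Q G <= (K * dyadic m `^ beta)%:E)%E &
    forall w y, V w y -> (forall i, `|y ord0 i - x ord0 i| <= dyadic m) -> G w].
Variable A : set 'rV[R]_n.
Hypothesis A_sub : forall x, A x -> forall i, `|x ord0 i| <= M.

Lemma hausdorff_gauge_ge0 (S : set 'rV[R]_n) : (0 <= hausdorff_gauge beta S)%E.
Proof. by rewrite /hausdorff_gauge; case: ifP => // _; exact: poweR_ge0. Qed.

(** Intersect the events for balls shrinking to [x]. This handles covering sets of diameter 0, whose
    gauge vanishes when [beta > 0]. *)
Lemma point_hitting (x : 'rV[R]_n) : 0 < beta -> A x ->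
  exists G, [/\ measurable G, Q G = 0 & forall w, V w x -> G w].
Proof.
move=> b0 Ax.
have /choice[G GP] : forall m, exists G, [/\ measurable G,
    (Q G <= (K * dyadic (N + m) `^ beta)%:E)%E & forall w, V w x -> G w].
  move=> m; have [G [mG QG VG]] := ball_le (leq_addr m N) (A_sub Ax).
  exists G; split => // w Vx; apply: VG Vx _ => i.
  by rewrite subrr normr0 ltW// dyadic_gt0.
have mG : measurable (\bigcap_m G m).
  by apply: bigcapT_measurable => m; have [] := GP m.
exists (\bigcap_m G m); split => //; last first.
  by move=> w Vx m _; have [_ _] := GP m; exact.
apply/eqP; rewrite eq_le measure_ge0 andbT; apply/lee_addgt0Pr => e e0.
(* [K + 1] replaces [K], which may be 0. *)
have eK : 0 < e / (K + 1) by rewrite divr_gt0// ltr_wpDl.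
have [m me] := dyadic_small (powR_gt0 beta^-1 eK).
have [mGm QGm _] := GP m.
apply: (@le_trans _ _ (Q (G m))).
  by apply: le_measure; rewrite ?inE//; exact: bigcap_inf.
apply: le_trans QGm _; rewrite add0e lee_fin.
have Nm : dyadic (N + m) `^ beta <= e / (K + 1).
  apply: (@le_trans _ _ (((e / (K + 1)) `^ beta^-1) `^ beta)).
    rewrite ge0_ler_powR ?nnegrE ?powR_ge0// ?(ltW (dyadic_gt0 _))//.
    by rewrite (le_trans _ (ltW me))// dyadic_le// leq_addl.
  by rewrite -powRrM mulVf ?gt_eqF// powRr1// ltW.
apply: (@le_trans _ _ (K * (e / (K + 1)))); first exact: ler_wpM2l.
by rewrite mulrCA ler_piMr ?(ltW e0)// ler_pdivrMr ?ltr_wpDl// mul1r lerDl.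
Qed.

(** A set meeting [A] lies in a ball centred at one of its points in [A], where the bound [M] holds,
    with a dyadic radius comparable to its diameter. *)
Lemma covering_piece (S : set 'rV[R]_n) :
  (euclidean_diam S <= (dyadic N / 2)%:E)%E ->
  exists G, [/\ measurable G,
    (Q G <= (K * 2 `^ beta + 1)%:E * hausdorff_gauge beta S)%E &
    forall w y, V w y -> A y -> S y -> G w].
Proof.
move=> Sd; set C := K * 2 `^ beta + 1.
have C0 : 0 <= C by rewrite addr_ge0// mulr_ge0// powR_ge0.
have [[x [Ax Sx]]|noAS] := pselect (exists x, A x /\ S x); last first.
  exists set0; split => //; first by rewrite measure0 mule_ge0// hausdorff_gauge_ge0.
  by move=> w y _ Ay Sy; apply: noAS; exists y.
have [r [Sr /andP[r0 rN] xr]] := euclidean_diam_fin Sx Sd.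
rewrite /hausdorff_gauge ifF; last first.
  by apply/negbTE/set0P; exists x.
rewrite Sr poweR_EFin -EFinM.
(* For [beta = 0] the gauge is 1, and the summand 1 in [C] makes the whole space admissible. *)
move: beta0; rewrite le_eqVlt => /predU1P[b0|b0].
  exists setT; split => //; rewrite -b0 powRr0 mulr1 (le_trans (probability_le1 _ _))//.
  by rewrite lee_fin /C lerDr mulr_ge0 ?powR_ge0.
move: r0; rewrite le_eqVlt => /predU1P[r0|r0].
  have [G [mG QG VG]] := point_hitting b0 Ax.
  exists G; split => //; first by rewrite QG lee_fin mulr_ge0 ?powR_ge0.
  move=> w y Vy _ Sy; suff yx : y = x by apply: VG; rewrite -yx.
  apply/rowP => i; apply/eqP; rewrite -subr_eq0 -normr_le0 r0.
  exact: xr.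
have rdN : r < dyadic N.
  by rewrite (le_lt_trans rN)// ltr_pdivrMr// ltr_pMr ?dyadic_gt0// ltr1n.
(* The radius overshoots [r] by a factor at most 2, which produces [2] to the power [beta] in the
   constant. *)
have [m Nm /andP[rm mr]] := dyadic_bracket r0 rdN.
have [G [mG QG VG]] := ball_le Nm (A_sub Ax).
exists G; split => //.
  apply: le_trans QG _; rewrite lee_fin.
  apply: (@le_trans _ _ (K * (2 * r) `^ beta)).
    by rewrite ler_wpM2l// ge0_ler_powR ?nnegrE ?(ltW (dyadic_gt0 _)) ?mulr_ge0// ltW.
  rewrite powRM ?(ltW r0)// mulrA ler_wpM2r ?powR_ge0//.
  by rewrite /C lerDl.
move=> w y Vy _ Sy; apply: VG Vy _ => i.
by rewrite (le_trans (xr _ Sy i))// ltW.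
Qed.

(** Countable subadditivity over each covering of mesh [dyadic N / 2], then the infimum over
    coverings; this premeasure is one term of the supremum defining the measure. *)
Lemma hitting_hausdorff_le : measurable [set w | V w `&` A !=set0] ->
  (Q [set w | V w `&` A !=set0] <=
   (K * 2 `^ beta + 1)%:E * hausdorff_measure beta A)%E.
Proof.
move=> mhit; set C := K * 2 `^ beta + 1.
have C0 : 0 < C by rewrite ltr_wpDl// mulr_ge0// powR_ge0.
have dN : 0 < dyadic N / 2 :> R by rewrite divr_gt0// dyadic_gt0.
rewrite /hausdorff_measure ltNge beta0/=.
apply: (@le_trans _ _ (C%:E * hausdorff_premeasure beta (dyadic N / 2) A)%E); last first.
  rewrite lee_wpmul2l ?lee_fin ?(ltW C0)//; apply: ereal_sup_ubound.
  by exists (dyadic N / 2) => //=; rewrite in_itv/= andbT.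
(* Strict positivity of [C] lets it enter the infimum. *)
rewrite -ereal_inf_pZl//; apply/ereal_infP => _ [_ [S [AS Sd] <-] <-].
have /choice[G GP] := fun k => covering_piece (Sd k).
have mG k : measurable (G k) by have [] := GP k.
apply: (@le_trans _ _ (\sum_(0 <= k <oo) Q (G k))%E).
  apply: measure_sigma_subadditive => // w [y [Vy Ay]].
  have [k _ Sy] := AS _ Ay; exists k => //.
  by have [_ _] := GP k; apply; [exact: Vy|..].
rewrite -nneseriesZl//; last by move=> k _; exact: hausdorff_gauge_ge0.
by apply: lee_nneseries => k _ //; have [] := GP k.
Qed.

End HausdorffCovering.

(** * The hitting probability bound *)

Theorem theorem2p3 (R : realType) (dO dO' : measure_display)
  (Omega : measurableType dO) (P : probability Omega R)
  (Omega' : measurableType dO') (Q : probability Omega' R)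
  (u v : R * R -> {RV P >-> R})
  (u_cont : continuous_field u) (v_cont : continuous_field v)
  (d : nat) (d_gt0 : (0 < d)%N)
  (U : 'I_d -> R * R -> {RV Q >-> R})
  (U_cont : forall i, continuous_field (U i))
  (U_indep : independent_fields U)
  (U_law : forall i, same_law (U i) u)
  (T : R) (T_gt0 : 0 < T)
  (I J : set R) (I_itv : compact_interval I) (J_itv : compact_interval J)
  (I_sub : I `<=` `]0, T])
  (C : R) (C_ge0 : 0 <= C)
  (X : R * R -> {RV P >-> R})
  (X_bound : forall z0, (I `*` J) z0 ->
     {ae P, forall w, `|X z0 w| <= C})
  (H1 H2 alpha : R) (H1_gt0 : 0 < H1) (H2_gt0 : 0 < H2) (alpha_gt1 : 1 < alpha)
  (hyp1 : \forall p \near \oo, exists C_Tp : R, \forall n \near \oo,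
     forall z0, (I `*` J) z0 ->
     let L z w := u z w - u z0 w - X z0 w * (v z w - v z0 w) in
     let Xn w := sup [set `|L z w| | z in
       `[z0.1, z0.1 + 2 `^ (- (n%:R * H1^-1))] `*`
       `[z0.2, z0.2 + 2 `^ (- (n%:R * H2^-1))]] in
     ('E_P[fun w => (Xn w ^+ p)%R] <=
       (C_Tp * 2 `^ (- (alpha * p%:R * n%:R)))%R%:E)%E)
  (hyp2 : exists pdf : R * R -> R -> R,
     (forall z, (I `*` J) z -> has_density P lebesgue_measure (u z) (pdf z)) /\
     forall M : R, 0 <= M -> exists K : R, forall z y,
       (I `*` J) z -> y \in `[- M, M] -> pdf z y <= K)
  (hyp3 : exists2 c : R, 0 < c & \forall eta \near 0^'+,
     forall z0, (I `*` J) z0 ->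
     let S := `[z0.1, z0.1 + eta `^ H1^-1] `*` `[z0.2, z0.2 + eta `^ H2^-1] in
     exists p_plus p_minus : R * R -> R,
     [/\ has_density P (lebesgue_measure \x lebesgue_measure)%E
           (fun w => (u z0 w, sup [set v z w - v z0 w | z in S])) p_plus,
         has_density P (lebesgue_measure \x lebesgue_measure)%E
           (fun w => (- u z0 w, sup [set - v z w + v z0 w | z in S])) p_minus &
         forall z1 z2, eta <= z2 ->
           p_plus (z1, z2) <= c / eta * expR (- (z2 ^+ 2 / (c * eta ^+ 2))) /\
           p_minus (z1, z2) <= c / eta * expR (- (z2 ^+ 2 / (c * eta ^+ 2)))]) :
  forall M : R, 0 < M -> exists Ct : R, forall A : set 'rV[R]_d,
    compact A -> (forall x, A x -> forall i, x ord0 i \in `[- M, M]) ->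
    (Q [set w | [set \row_(i < d) U i z w | z in I `*` J] `&` A !=set0] <=
      Ct%:E * hausdorff_measure (d%:R - H1^-1 - H2^-1) A)%E.
Proof.
case: I_itv => a [b [ab Iab]]; case: J_itv => a' [b' [ab' Jab']] M M0.
have [K [K0 [N KN]]] := near_hit_uniform u_cont v_cont I_sub C_ge0 X_bound
  alpha_gt1 hyp1 hyp2 hyp3 M0.
set beta := d%:R - H1^-1 - H2^-1.
pose K' := (b - a + 1) * (b' - a' + 1) * K ^+ d.
have K'0 : 0 <= K' by rewrite !mulr_ge0 ?exprn_ge0//; lra.
exists (K' * 2 `^ beta + 1) => A cA AM.
(* For [beta < 0] the right-hand side is [+oo], since the constant is positive. *)
have [b0|b0] := ltP beta 0.
  rewrite /hausdorff_measure b0 gt0_muley ?leey// lte_fin.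
  by rewrite ltr_wpDl// mulr_ge0// powR_ge0.
have a0 : 0 <= a.
  have : I a by rewrite Iab /= in_itv/= lexx ltW.
  by move=> /I_sub/=; rewrite in_itv/= => /andP[/ltW].
have IJS : I `*` J `<=` spacetime.
  move=> z [Iz _]; split => //=; rewrite in_itv/= andbT.
  by move: Iz => /I_sub/=; rewrite in_itv/= => /andP[/ltW].
have IJr : I `*` J = rectangle (a, a') (b - a) (b' - a').
  by rewrite /rectangle/= !subrKC Iab Jab'.
apply: (@hitting_hausdorff_le _ _ _ _ _ beta K' M N
  (fun w => [set \row_(i < d) U i z w | z in I `*` J])) => //.
- move=> m Nm x xM.
  have [|G [mG QG GP]] := ball_hitting (N := N) U_cont U_indep U_law
    a0 (ltW ab) (ltW ab') H1_gt0 H2_gt0 K0 _ Nm xM.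
    by rewrite -Iab -Jab'.
  exists G; split => // w _ [z Iz <-] hz; apply: (GP w z); rewrite -?Iab -?Jab'//.
  by move=> i; have := hz i; rewrite mxE.
- by move=> x Ax i; have := AM x Ax i; rewrite in_itv/= -ler_norml.
have [s sD] : exists s, dense_seq (I `*` J) s.
  by rewrite IJr; apply: rectangle_dense_seq; rewrite subr_ge0 ltW.
apply: hitting_event_measurable sD cA => //.
by rewrite IJr; exact: rectangle_compact.
Qed.
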